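(* For every finite simple graph $G$ with at least one edge, $1 \le c(G) \le 2$.
   Context: For a positive integer $h$ and a finite simple graph $G$ with $n$ vertices and $k$ connected components, fix one vertex in each connected component of $G$, and let $\mathrm{Lip}(G;h)$ be the set of functions $f: V(G) \to \mathbb{Z}$ such that $f$ takes the value $0$ at each of the fixed vertices and $|f(x)-f(y)| \le h$ for every edge $\{x,y\} \in E(G)$. The cardinality $|\mathrm{Lip}(G;h)|$ does not depend on the choice of fixed vertices. If $k < n$ (equivalently, $G$ has at least one edge), define $c(G) = \lim_{h\to\infty} \frac{1}{h}\,|\mathrm{Lip}(G;h)|^{1/(n-k)}$ (limit over positive integers $h$; this limit exists). *)

(* Defs.v *)
From HB Require Import structures.
From mathcomp Require Import all_boot all_order all_algebra.
From mathcomp Require Import finmap.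
From mathcomp Require Import all_classical all_reals all_analysis.

Set Implicit Arguments.
Unset Strict Implicit.
Unset Printing Implicit Defensive.

Import Order.TTheory GRing.Theory Num.Theory.
Import numFieldNormedType.Exports.

Local Open Scope ring_scope.

(* A finite simple graph is a symmetric irreflexive relation [e] on a finType. *)

Definition components (T : finType) (e : rel T) : {set {set T}} :=
  equivalence_partition (connect e) [set: T]%SET.

(* [S] contains exactly one vertex of each connected component. *)
Definition root_set (T : finType) (e : rel T) (S : {set T}) : bool :=
  is_transversal S (components e) [set: T]%SET.

Definition Lip (T : finType) (e : rel T) (S : {set T}) (h : nat) :
    set {ffun T -> int} :=
  [set f : {ffun T -> int} | (forall x, x \in S -> f x = 0) /\
    (forall x y, e x y -> `|f x - f y| <= h%:Z)]%classic.

(* [fset_set] is only meaningful on finite sets; [Lip e S h] is finite as soon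
   as [S] meets every connected component. *)
Definition card_Lip (T : finType) (e : rel T) (S : {set T}) (h : nat) : nat :=
  #|` fset_set (Lip e S h)|%fset.

(* The term at [h = 0] is [0^-1 * _ = 0] and does not affect the limit.  [lim]
   returns the default point [0] of [R] on a divergent sequence, so a positive
   lower bound on [Lip_const] entails convergence. *)
Definition Lip_const (R : realType) (T : finType) (e : rel T) (S : {set T}) : R :=
  limn (fun h : nat => h%:R^-1 *
    ((card_Lip e S h)%:R `^ ((#|T| - #|components e|)%N%:R)^-1) : R).

(* Main.v *)
(* Write N(h) = |Lip(G;h)| and d = n - k.  Dividing values by m with rounding
   down maps Lip(G;mh) to Lip(G;h) with fibres of size at most m^d, so
   u(h) = N(h)^(1/d) satisfies u(mh) <= m u(h); since u is also nondecreasing,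
   u(h)/h converges to its infimum.  A function with values in {0..h} off the
   roots is Lipschitz, and a Lipschitz function is determined by its increments
   along a spanning forest, so (h+1)^d <= N(h) <= (2h+1)^d. *)
Require Import Defs.
From mathcomp Require Import all_boot all_order all_algebra finmap zify.
From mathcomp Require Import all_classical all_reals all_analysis.

Set Implicit Arguments.
Unset Strict Implicit.
Unset Printing Implicit Defensive.

Import Order.TTheory GRing.Theory Num.Theory.
Import numFieldNormedType.Exports.
Local Open Scope ring_scope.

(** This turns the exponent $n-k$ into the size of a type, so that each power below is the cardinal
    of a space of functions on the non-root vertices. *)
Lemma root_set_card (T : finType) (e : rel T) (S : {set T}) :
  root_set e S -> #|{: {x : T | x \notin S}}| = (#|T| - #|components e|)%N.
Proof.
move=> S_roots; rewrite card_sig -(card_transversal S_roots) -(cardC (mem S)) addKn.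
by apply: eq_card.
Qed.

Lemma connect_equivalence (T : finType) (e : rel T) :
  symmetric e -> {in [set: T] & &, equivalence_rel (connect e)}%SET.
Proof.
move=> e_sym x y z _ _ _; split; first exact: connect0.
by move=> xy; apply: same_connect xy _; apply: sym_connect_sym.
Qed.

Lemma root_set_connect (T : finType) (e : rel T) (S : {set T}) (x : T) :
  symmetric e -> root_set e S -> exists2 s, s \in S & connect e x s.
Proof.
move=> e_sym S_roots.
have eqv := connect_equivalence e_sym.
have xP : finset.pblock (components e) x \in components e.
  by rewrite finset.pblock_mem ?(finset.cover_partition (equivalence_partitionP eqv)) ?inE.
exists (transversal_repr x S (finset.pblock (components e) x)).
  exact: repr_mem_transversal S_roots _ _ xP.
have := repr_mem_pblock S_roots x xP.
by rewrite (pblock_equivalence_partition eqv) ?inE.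
Qed.

Lemma root_set_inj (T : finType) (e : rel T) (S : {set T}) (x y : T) :
  symmetric e -> root_set e S -> x \in S -> y \in S -> connect e x y -> x = y.
Proof.
move=> e_sym S_roots xS yS xy; have eqv := connect_equivalence e_sym.
apply: (pblock_inj S_roots) => //; apply/eqP.
have /and3P[/eqP cov tri _] := equivalence_partitionP eqv.
by rewrite eq_pblock ?(pblock_equivalence_partition eqv) ?cov ?inE.
Qed.

(** A rooted spanning forest: [rk] is the length of a shortest walk to [S], and [p] is the next
    vertex on such a walk. *)
Lemma root_set_parent (T : finType) (e : rel T) (S : {set T}) :
  symmetric e -> root_set e S ->
  exists (rk : T -> nat) (p : T -> T),
    forall x, x \notin S -> e x (p x) /\ (rk (p x) < rk x)%N.
Proof.
move=> e_sym S_roots.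
have walk x : exists n, `[< exists s, [/\ path e x s, last x s \in S & size s = n] >].
  have [s sS /connectP[w w_path sE]] := root_set_connect x e_sym S_roots.
  by exists (size w); apply/asboolP; exists w; rewrite -sE.
pose rk x := ex_minn (walk x).
have step x : exists y, x \notin S -> e x y /\ (rk y < rk x)%N.
  have [xS|xS] := boolP (x \in S); first by exists x.
  rewrite /rk; case: (ex_minnP (walk x)) => n /asboolP[[|y s] [/= ys_path ys_last <-]] _.
    by rewrite ys_last in xS.
  case/andP: ys_path => xy s_path; exists y => _; split=> //.
  (* The tail of a minimal walk from [x] is a walk from [y], one step shorter. *)
  case: ex_minnP => m _; apply; apply/asboolP; by exists s.
exists rk, (fun x => sval (cid (step x))) => x.
exact: (svalP (cid (step x))).
Qed.

Section Lip.
Context (T : finType) (e : rel T) (S : {set T}).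
Context (e_sym : symmetric e) (S_roots : root_set e S).
Local Notation D := {x : T | x \notin S}.

Lemma Lip_increments h : exists f : {ffun T -> int} -> {ffun D -> 'I_h.*2.+1},
  {in Lip e S h &, injective f}.
Proof.
have [rk [p pP]] := root_set_parent e_sym S_roots.
(* Increments along parent edges lie in $[-h,h]$. Adding $h$ moves them to $[0,2h]$, where [absz]
   and [inord] lose nothing. *)
exists (fun f => [ffun u : D => inord (absz (f (val u) - f (p (val u)) + h%:Z))]).
move=> f g; rewrite !inE => -[f0 fL] [g0 gL] /ffunP fg; apply/ffunP => x.
(* Induction on [rk]: the value at [x] is the value at its parent plus the increment. *)
have [n] := ubnP (rk x); elim: n x => // n IH x xn.
have [xS|xS] := boolP (x \in S); first by rewrite f0 ?g0.
have [xp px] := pP x xS.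
have := IH _ (leq_trans px xn); have := fg (Sub x xS).
rewrite !ffunE /= => /(congr1 val); rewrite /= !inordK.
- have := fL _ _ xp; have := gL _ _ xp; lia.
- have := gL _ _ xp; lia.
- have := fL _ _ xp; lia.
Qed.

Lemma finite_Lip h : finite_set (Lip e S h).
Proof.
have [f f_inj] := Lip_increments h.
by rewrite -(eq_finite_set (inj_card_eq f_inj)); apply: finite_finset.
Qed.

Lemma fset_LipP h (f : {ffun T -> int}) :
  reflect (Lip e S h f) (f \in fset_set (Lip e S h)).
Proof. by rewrite in_fset_set; [apply: (iffP idP); rewrite inE|apply: finite_Lip]. Qed.

Lemma card_Lip_le h : (card_Lip e S h <= h.*2.+1 ^ (#|T| - #|components e|))%N.
Proof.
have [f f_inj] := Lip_increments h.
rewrite -(root_set_card S_roots) /card_Lip cardfE.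
rewrite -[X in (_ <= X ^ _)%N]card_ord -card_ffun.
apply: (leq_card (fun g : fset_set (Lip e S h) => f (val g))) => g1 g2 eq12.
by apply/val_inj/f_inj => //; rewrite inE; apply/fset_LipP/valP.
Qed.

(** Any choice of values in $[0,h]$ off the roots, extended by 0, is Lipschitz: two values differ by
    at most $h$, whatever the edges. *)
Lemma card_Lip_ge h : (h.+1 ^ (#|T| - #|components e|) <= card_Lip e S h)%N.
Proof.
rewrite -(root_set_card S_roots) /card_Lip cardfE.
rewrite -[X in (X ^ _ <= _)%N]card_ord -card_ffun.
pose F (g : {ffun D -> 'I_h.+1}) : {ffun T -> int} :=
  [ffun x => if insub x is Some u then (g u)%:Z else 0].
have FL g : F g \in fset_set (Lip e S h).
  apply/fset_LipP; split=> [x xS|x y _]; rewrite !ffunE; first by rewrite insubN ?negbK.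
  by case: insubP => [u _ _|_]; [have := ltn_ord (g u)|];
    (case: insubP => [v _ _|_]; [have := ltn_ord (g v)|]); lia.
apply: (leq_card (fun g => [` FL g]%fset)) => g1 g2 /(congr1 val)/ffunP eq12.
by apply/ffunP => u; apply/val_inj; have := eq12 (val u); rewrite !ffunE valK => -[].
Qed.

Lemma card_Lip_homo : {homo card_Lip e S : h h' / (h <= h')%N}.
Proof.
move=> h h' le_h; apply/fsubset_leq_card/fsubsetP => f /fset_LipP[f0 fL].
by apply/fset_LipP; split=> // x y /fL; lia.
Qed.

Lemma card_Lip_mul m h : (0 < m)%N ->
  (card_Lip e S (m * h) <= m ^ (#|T| - #|components e|) * card_Lip e S h)%N.
Proof.
case: m => // m _; rewrite -(root_set_card S_roots) [(_ * card_Lip e S h)%N]mulnC /card_Lip !cardfE.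
rewrite -[X in (_ <= _ * (X ^ _))%N]card_ord -card_ffun -card_prod.
pose Q (f : {ffun T -> int}) : {ffun T -> int} := [ffun x => (f x %/ m.+1)%Z].
have QL (f : fset_set (Lip e S (m.+1 * h))) : Q (val f) \in fset_set (Lip e S h).
  have /fset_LipP[f0 fL] := valP f.
  apply/fset_LipP; split=> [x xS|x y /fL]; rewrite !ffunE; first by rewrite f0 ?div0z.
  (* Remainders differ by less than $m+1$, so the quotients differ by less than $h+1$, hence by at
     most $h$. *)
  have := divz_eq (val f x) m.+1; have := divz_eq (val f y) m.+1.
  have := modz_ge0 (val f x) (isT : m.+1%:Z != 0).
  have := modz_ge0 (val f y) (isT : m.+1%:Z != 0).
  have := ltz_pmod (val f x) (isT : 0 < m.+1%:Z).
  have := ltz_pmod (val f y) (isT : 0 < m.+1%:Z).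
  nia.
pose r (f : {ffun T -> int}) :=
  [ffun u : D => inord (absz (f (val u) %% m.+1)%Z) : 'I_m.+1].
(* Quotients together with the remainders off the roots determine [f], which vanishes on the
   roots. *)
apply: (leq_card (fun f => ([` QL f]%fset, r (val f)))) => f g.
case=> /ffunP eqQ /ffunP eqr; apply/val_inj/ffunP => x.
have /fset_LipP[f0 _] := valP f; have /fset_LipP[g0 _] := valP g.
have [xS|xS] := boolP (x \in S); first by rewrite f0 ?g0.
rewrite (divz_eq (val f x) m.+1) (divz_eq (val g x) m.+1).
have := eqQ x; rewrite !ffunE => ->; congr (_ + _).
have := modz_ge0 (val f x) (isT : m.+1%:Z != 0).
have := modz_ge0 (val g x) (isT : m.+1%:Z != 0).
have := ltz_pmod (val f x) (isT : 0 < m.+1%:Z).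
have := ltz_pmod (val g x) (isT : 0 < m.+1%:Z).
have := eqr (Sub x xS); rewrite !ffunE /= => /(congr1 val) /=.
move: (val f x %% _)%Z (val g x %% _)%Z => a b + b_lt a_lt b_ge a_ge.
by rewrite !inordK; lia.
Qed.

End Lip.

(* A variant of Fekete's lemma: monotonicity replaces full subadditivity. *)
Lemma cvg_div_inf (R : realType) (u : nat -> R) : (forall n, 0 <= u n) ->
  {homo u : m n / (m <= n)%N >-> m <= n} ->
  (forall m n, (0 < m)%N -> u (m * n)%N <= m%:R * u n) ->
  (n%:R^-1 * u n @[n --> \oo] -->
    inf [set n.+1%:R^-1 * u n.+1 | n in [set: nat]])%classic.
Proof.
move=> u0 u_homo u_mul; set E := (X in inf X).
have E0 : lbound E 0 by move=> _ [n _ <-]; rewrite mulr_ge0.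
have infE : has_inf E by split; [exists (1^-1 * u 1%N), 0%N | exists 0].
apply/cvgrPdist_lt => eps eps0.
(* The term at [q.+1] is within [eps / 2] of the infimum; the other half pays for rounding [n] up to
   a multiple of [q.+1]. *)
have [_ [q _ <-] q_lt] := inf_adherent (divr_gt0 eps0 (ltr0n R 2)) infE.
near=> n.
(* [E] is indexed from 1, so the infimum bounds only terms with positive index. *)
have n0 : (0 < n)%N by near: n; exists 1%N.
have nR0 : 0 < n%:R :> R by rewrite ltr0n.
have inf_le : inf E <= n%:R^-1 * u n.
  by apply: ge_inf; [exists 0|exists n.-1 => //; rewrite prednK].
have n_big : u q.+1 / (eps / 2) < n%:R.
  by near: n; apply: nbhs_infty_gtr.
rewrite ltr_pdivrMr in n_big; last by rewrite divr_gt0.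
have un_le : u n <= (n %/ q.+1)%N.+1%:R * u q.+1.
  by apply: le_trans (u_mul _ _ _) => //; apply/u_homo/ltnW/ltn_ceil.
have div_le : (n %/ q.+1)%:R <= n%:R * q.+1%:R^-1 :> R.
  by rewrite ler_pdivlMr ?ltr0n // -natrM ler_nat leq_divM.
rewrite distrC ger0_norm ?subr_ge0 // ltrBlDr mulrC ltr_pdivrMr //.
rewrite -natr1 mulrDl mul1r in un_le; apply: le_lt_trans un_le _.
have -> : (eps + inf E) * n%:R = n%:R * (inf E + eps / 2) + n%:R * (eps / 2).
  by rewrite -mulrDr -addrA -splitr addrC mulrC.
apply: ltrD n_big; apply: le_lt_trans (ler_wpM2r (u0 q.+1) div_le) _.
by rewrite -mulrA ltr_pM2l.
Unshelve. all: by end_near.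
Qed.

Theorem theorem1p2p1 (R : realType) (T : finType) (e : rel T)
    (e_sym : symmetric e) (e_irr : irreflexive e)
    (e_edge : exists x y : T, e x y)
    (S : {set T}) (S_roots : root_set e S) :
  1 <= Lip_const R e S <= 2.
Proof.
(* The ends of an edge are distinct and in one component, so they are not both roots. *)
have d0 : (0 < #|T| - #|components e|)%N.
  have [x [y xy]] := e_edge; rewrite -(root_set_card S_roots).
  have [xS|xS] := boolP (x \in S); last by apply/card_gt0P; exists (Sub x xS).
  have [yS|yS] := boolP (y \in S); last by apply/card_gt0P; exists (Sub y yS).
  by move: (xy); rewrite (root_set_inj e_sym S_roots xS yS (connect1 xy)) e_irr.
rewrite /Lip_const; set d := (_ - _)%N in d0 *.
pose u h : R := (card_Lip e S h)%:R `^ d%:R^-1.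
have u0 h : 0 <= u h by apply: powR_ge0.
have root_homo (x y : R) : 0 <= x -> x <= y -> x `^ d%:R^-1 <= y `^ d%:R^-1.
  move=> x0 xy; apply: ge0_ler_powR; rewrite ?nnegrE ?invr_ge0 //.
  exact: le_trans xy.
have root_exp n : (n ^ d)%:R `^ d%:R^-1 = n%:R :> R.
  by rewrite natrX -powR_mulrn // -powRrM divff ?powRr1 // pnatr_eq0 -lt0n.
have u_homo : {homo u : m n / (m <= n)%N >-> m <= n}.
  by move=> m n mn; apply: root_homo => //; rewrite ler_nat card_Lip_homo.
have u_mul m n : (0 < m)%N -> u (m * n)%N <= m%:R * u n.
  move=> m0; rewrite -[m%:R]root_exp -powRM // -natrM.
  by apply: root_homo => //; rewrite ler_nat card_Lip_mul.
have u_ge h : h.+1%:R <= u h.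
  by rewrite -root_exp; apply: root_homo => //; rewrite ler_nat card_Lip_ge.
have u_le h : u h <= h.*2.+1%:R.
  by rewrite -[leRHS]root_exp; apply: root_homo => //; rewrite ler_nat card_Lip_le.
have u_cvg := cvg_div_inf u0 u_homo u_mul.
(* As the limit is an infimum, the lower bound is checked on every term, while the upper bound needs
   only one suitable term for each [eps]. *)
rewrite (cvg_lim _ u_cvg) //; apply/andP; split.
  apply: lb_le_inf; first by exists (1^-1 * u 1%N), 0%N.
  move=> _ [n _ <-]; rewrite ler_pdivlMl ?ltr0n // mulr1.
  by apply: le_trans (u_ge _); rewrite ler_nat.
apply/ler_addgt0Pr => eps eps0.
(* The bound [u_le] at index $n+1$ gives $(2(n+1)+1)/(n+1) = 2 + 1/(n+1)$. *)
have [n n_eps] : exists n, 2 + n.+1%:R^-1 < 2 + eps.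
  by apply: ltr_add_invr; rewrite ltrDl.
apply: le_trans (ltW n_eps).
apply: le_trans (_ : n.+1%:R^-1 * u n.+1 <= _).
  by apply: ge_inf; [exists 0 => _ [k _ <-]; rewrite mulr_ge0 | exists n].
rewrite ler_pdivrMl ?ltr0n // mulrDr divff ?pnatr_eq0 //.
by apply: le_trans (u_le _) _; rewrite -natrM -natr1 lerD2r ler_nat muln2.
Qed.
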